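(* Let $i\in\mathcal{A}$ and let $x_i=[v_i,s_i]^\top\in\mathcal{C}_{\underline{v},i}\cap\mathcal{C}_{\overline{v},i}$. The CBFs $h_{\overline{v},i}(x_i)=-v_i+\overline{v}_i$ and $h_{\underline{v},i}(x_i)=v_i-\underline{v}_i$ exhibit a control-sharing property, that is, $K_{\underline{v},i}(x_i)\cap K_{\overline{v},i}(x_i)\neq\emptyset$, if and only if the inequality $$-\lambda_{\underline{v}}v_i\le -\lambda_{\overline{v}}v_i+\lambda_{\overline{v}}\overline{v}_i$$ holds. This inequality can, e.g., be satisfied by choosing $\lambda_{\underline{v}}\ge\lambda_{\overline{v}}$.
   Context: Agents: $\mathcal{A}=\{1,\dots,N_\mathcal{A}\}$. Agent $i$ has state $x_i=[v_i,s_i]^\top$ (velocity and path coordinate), input $u_i=a_{x,i}$ (longitudinal acceleration), and dynamics $\dot x_i=f_i(x_i)+g_i(x_i)u_i$ with $f_i(x_i)=[-F_{r,i}(v_i)/m_i,\ v_i]^\top$, $g_i(x_i)=[1,0]^\top$, mass $m_i>0$, and resistance force $F_{r,i}(v_i)=\mathrm{sign}(v_i)c_{0,i}+c_{1,i}v_i+c_{2,i}v_i^2$ with $c_{0,i},c_{1,i},c_{2,i}\in\mathbb{R}$. Input constraints: $u_i\in\mathcal{U}_i=[\underline{a}_{x,i},\overline{a}_{x,i}]$ with $\underline{a}_{x,i}<0<\overline{a}_{x,i}$. Velocity bounds: minimum velocity $\underline{v}_i=0$ and maximum velocity $\overline{v}_i$. Safe sets: $\mathcal{C}_{\underline{v},i}=\{x_i: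 h_{\underline{v},i}(x_i)\ge 0\}$, $\mathcal{C}_{\overline{v},i}=\{x_i: h_{\overline{v},i}(x_i)\ge 0\}$. With Lie derivatives $L_{f_i}h=\frac{\partial h}{\partial x_i}f_i$, $L_{g_i}h=\frac{\partial h}{\partial x_i}g_i$ and constants $\lambda_{\underline{v}},\lambda_{\overline{v}}>0$, the control sets are $K_{\underline{v},i}(x_i)=\{u_i\in\mathcal{U}_i: L_{f_i}h_{\underline{v},i}(x_i)+L_{g_i}h_{\underline{v},i}(x_i)u_i+\lambda_{\underline{v}}h_{\underline{v},i}(x_i)\ge0\}$ and $K_{\overline{v},i}(x_i)=\{u_i\in\mathcal{U}_i: L_{f_i}h_{\overline{v},i}(x_i)+L_{g_i}h_{\overline{v},i}(x_i)u_i+\lambda_{\overline{v}}h_{\overline{v},i}(x_i)\ge0\}$. Control-sharing property: CBFs $h_1,\dots,h_N$ have the control-sharing property if the intersection of their sets of controls is non-empty, $\bigcap_k K_k(x)\ne\emptyset$.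
   Formalization: ''The CBFs'' is made an explicit hypothesis with the same gains as in the control sets: each control set alone is non-empty on a domain containing the state. Without it the ''if'' part fails, e.g. when resistance exceeds what the bounded input can offset. *)

(* Defs.v *)
From HB Require Import structures.
From mathcomp Require Export all_boot all_order all_algebra.
From mathcomp Require Export all_classical all_reals all_analysis.
Export Order.TTheory GRing.Theory Num.Theory.
Export numFieldNormedType.Exports.

Set Implicit Arguments.
Unset Strict Implicit.
Unset Printing Implicit Defensive.

Local Open Scope classical_set_scope.
Local Open Scope ring_scope.

(* State [v, s]^T : velocity and path coordinate. *)
Notation state R := 'cV[R]_2.

Definition vel (R : realType) (x : state R) : R := x ord0 ord0.

Record vehicle (R : realType) := Vehicle {
  mass : R ;
  c0 : R ;
  c1 : R ;
  c2 : R ;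
  amin : R ;
  amax : R ;
  vmax : R ;
  mass_gt0 : 0 < mass ;
  amin_lt0 : amin < 0 ;
  amax_gt0 : 0 < amax }.

Section Dynamics.
Variables (R : realType) (V : vehicle R).

Definition resistance (v : R) : R := Num.sg v * c0 V + c1 V * v + c2 V * v ^+ 2.

Definition drift (x : state R) : state R :=
  \col_(k < 2) if k == ord0 then - resistance (vel x) / mass V else vel x.

Definition input_field (x : state R) : state R :=
  \col_(k < 2) if k == ord0 then 1 else 0.

Definition inputs : set R := `[amin V, amax V]%classic.

Definition vmin : R := 0.

Definition h_min (x : state R) : R := vel x - vmin.
Definition h_max (x : state R) : R := - vel x + vmax V.

End Dynamics.

Arguments vmin {R}.

Definition safe_set (R : realType) (h : state R -> R) : set (state R) :=
  [set x | 0 <= h x].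

(* The row vector dh/dx of partial derivatives. *)
Definition grad (R : realType) (h : state R -> R) (x : state R) : 'rV[R]_2 :=
  \row_(k < 2) 'D_(delta_mx k ord0) h x.

Definition lie (R : realType) (F : state R -> state R) (h : state R -> R)
    (x : state R) : R :=
  (grad h x *m F x) ord0 ord0.

Definition control_set (R : realType) (V : vehicle R) (lambda : R)
    (h : state R -> R) (x : state R) : set R :=
  [set u | inputs V u /\
           0 <= lie (drift V) h x + lie (@input_field R) h x * u
                + lambda * h x].

(* h is a control barrier function on D, for the linear class-K function
   r |-> lambda * r: at each state of D some admissible input satisfies the
   barrier inequality.  No smoothness of h is demanded; it is meant
   for the affine functions h_min and h_max. *)
Definition is_cbf (R : realType) (V : vehicle R) (lambda : R)
    (h : state R -> R) (D : set (state R)) : Prop :=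
  forall x, D x -> control_set V lambda h x !=set0.

(* Main.v *)
Require Import Defs.
From mathcomp Require Import ring lra.
Local Open Scope classical_set_scope.
Local Open Scope ring_scope.

(** Both barriers are affine in the velocity, with slopes [1] and [-1], and the
    input enters the velocity equation with coefficient [1].  With [r] the
    resistive deceleration, the barrier conditions are therefore a lower and an
    upper bound on the input,
    [r - lambda_min * v <= u]  and  [u <= r + lambda_max * (vmax - v)],
    both to be met inside the interval of admissible inputs.  Intersecting two
    intervals with a third one is a one-dimensional Helly situation: three
    intervals that meet pairwise have a common point.  The barrier property of
    each function says that its half-line meets the admissible interval, so
    what is left is that the two half-lines meet, which is the inequality of
    the theorem after cancelling [r].  The sufficient condition on the gains
    follows from a safe velocity lying between [0] and [vmax].  The slopes come
    from [derive_affine_vel], the half-lines from [control_set_affineE]. *)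

(** The difference quotient of an affine function is constant in the
    step, so the limit defining the derivative is that constant. *)
Lemma derive_affine_vel (R : realType) (a c : R) (x w : state R) :
  'D_w (fun y => a * vel y + c) x = a * vel w.
Proof.
apply: cvg_lim => //.
apply: (@cvg_trans _ (cst (a * vel w) @ 0^')); last exact: cvg_cst.
apply: near_eq_cvg; near=> t.
have t0 : t != 0 by near: t; exact: nbhs_dnbhs_neq.
rewrite /= /vel !mxE /GRing.scale /=.
by field.
Unshelve. all: by end_near. Qed.

Lemma lie_affine_vel (R : realType) (F : state R -> state R) (a c : R)
    (x : state R) :
  lie F (fun y => a * vel y + c) x = a * vel (F x).
Proof.
rewrite /lie mxE big_ord_recl big_ord1 !mxE !derive_affine_vel /vel !mxE /=.
by rewrite mulr1 mulr0 mul0r addr0.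
Qed.

(** Along an affine function of the velocity, the barrier inequality only sees
    the first component of the dynamics, which makes it affine in the input
    with the slope of the barrier. *)
Lemma control_set_affineE (R : realType) (V : vehicle R) (lambda a c : R)
    (x : state R) (u : R) :
  control_set V lambda (fun y => a * vel y + c) x u <->
  [/\ amin V <= u, u <= amax V &
      0 <= - a * (resistance V (vel x) / mass V) + a * u
           + lambda * (a * vel x + c)].
Proof.
rewrite /control_set /= !lie_affine_vel /inputs /= in_itv /= /vel !mxE /= mulr1.
rewrite mulNr mulrN -(mulNr a).
split=> [[/andP[lo hi] ?] //|[lo hi ?]].
by split=> //; rewrite lo hi.
Qed.

Lemma h_minE (R : realType) :
  @h_min R = fun y => 1 * vel y + 0.
Proof. by apply/funext => y; rewrite /h_min /vmin subr0 mul1r addr0. Qed.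

Lemma h_maxE (R : realType) (V : vehicle R) :
  h_max V = fun y => -1 * vel y + vmax V.
Proof. by apply/funext => y; rewrite /h_max mulN1r. Qed.

(** Helly's theorem on the line, for a segment and two opposite half-lines. *)
Lemma segment_half_lines_meet (R : realType) (a b lo hi : R) :
  a <= b -> lo <= b -> a <= hi -> lo <= hi ->
  exists u, [/\ a <= u, u <= b, lo <= u & u <= hi].
Proof.
move=> ab lob ahi lohi; exists (Num.max a lo).
by rewrite !le_max !ge_max !lexx ab lob ahi lohi orbT.
Qed.

Theorem proposition2 (R : realType) (N : nat) (agent : 'I_N -> vehicle R)
    (lambda_min lambda_max : R)
    (lambda_min_gt0 : 0 < lambda_min) (lambda_max_gt0 : 0 < lambda_max)
    (i : 'I_N) (x : state R)
    (x_safe : (safe_set (@h_min R) `&` safe_set (h_max (agent i))) x) :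
  (forall (D : set (state R)), D x ->
     is_cbf (agent i) lambda_min (@h_min R) D ->
     is_cbf (agent i) lambda_max (h_max (agent i)) D ->
     (control_set (agent i) lambda_min (@h_min R) x
        `&` control_set (agent i) lambda_max (h_max (agent i)) x !=set0
      <-> - lambda_min * vel x
          <= - lambda_max * vel x + lambda_max * vmax (agent i)))
  /\
  (lambda_max <= lambda_min ->
     - lambda_min * vel x
       <= - lambda_max * vel x + lambda_max * vmax (agent i)).
Proof.
split=> [D Dx cbf_min cbf_max|le_lambda]; last first.
  case: x_safe; rewrite /safe_set /h_min /h_max /vmin /= => v_ge0 v_le.
  (* A safe velocity lies in [0, vmax], so [- lambda_min * v] is at most
     [- lambda_max * v], to which a nonnegative term is added. *)
  nra.
have [umin] := cbf_min x Dx; have [umax] := cbf_max x Dx.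
rewrite h_minE h_maxE => /control_set_affineE[amin_umax _ bar_umax].
move=> /control_set_affineE[_ umin_amax bar_umin].
set r := resistance _ _ / _ in bar_umax bar_umin.
split=> [[u [/control_set_affineE[_ _ bar1] /control_set_affineE[_ _ bar2]]]|].
  rewrite -/r in bar1 bar2; lra.
move=> le_bounds.
have [||||u [lo hi bar1 bar2]] := @segment_half_lines_meet R (amin (agent i))
  (amax (agent i)) (r - lambda_min * vel x)
  (r + lambda_max * (vmax (agent i) - vel x)).
- by rewrite ltW // (lt_trans (amin_lt0 _) (amax_gt0 _)).
- lra.
- lra.
- lra.
by exists u; split; apply/control_set_affineE; split=> //; rewrite -/r; lra.
Qed.
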